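(* Suppose $C=ZL$ (component-wise product) is a Compound Laplacian (CL) distribution on $\mathbb{R}^n$, and let $R(\mathbf{c})=\sum_{i=1}^n R_i(c_i)$ with $R_i(c_i)=\log\left(p_{C_i}(0)/p_{C_i}(c_i)\right)$, where $p_{C_i}$ is the density of the component $C_i$. Then $R:\mathbb{R}^n\to\mathbb{R}$ is a subadditive, even function.
   Context: A CL distribution is that of $C=(C_1,\dots,C_n)$ with independent components $C_i=Z_iL_i$, where $L_i\sim\mathcal{L}(0,\lambda)$ is Laplace with density $\frac{\lambda}{2}e^{-\lambda|x|}$ ($\lambda>0$), and $Z_i$ is a mixing random variable supported on $[0,\infty)$ with density $p_{Z_i}$, independent of $L_i$. The density of $C_i$ is $$p_{C_i}(c_i)=\int_0^\infty\frac{\lambda}{2}e^{-\lambda|c_i|/z_i}\,\frac{p_{Z_i}(z_i)}{z_i}\,dz_i .$$ The function $R_i$ is assumed well defined, i.e. $p_{C_i}(0)<\infty$. Subadditive means $R(\mathbf{x}+\mathbf{y})\le R(\mathbf{x})+R(\mathbf{y})$ for all $\mathbf{x},\mathbf{y}\in\mathbb{R}^n$; even means $R(-\mathbf{x})=R(\mathbf{x})$. *)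

(* Defs.v *)
(* Libraries: MathComp and MathComp-Analysis. *)
From HB Require Import structures.
From mathcomp Require Import all_boot all_order all_algebra.
From mathcomp Require Import all_classical all_reals all_analysis measurable_realfun.

Set Implicit Arguments.
Unset Strict Implicit.
Unset Printing Implicit Defensive.
Import Order.TTheory GRing.Theory Num.Theory.
Import numFieldNormedType.Exports.
Local Open Scope classical_set_scope.
Local Open Scope ring_scope.

(* Densities are with respect to Lebesgue measure; the value +oo is allowed
   because the mixture density below can be infinite at the origin. *)
Definition has_density (R : realType) (d : measure_display)
    (T : measurableType d) (P : probability T R) (X : {RV P >-> R})
    (p : R -> \bar R) : Prop :=
  [/\ measurable_fun [set: R] p,
      (forall x, (0 <= p x)%E) &
      forall A : set R, measurable A ->
        P (X @^-1` A) = (\int[lebesgue_measure]_(x in A) p x)%E].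

Definition independent2 (R : realType) (d : measure_display)
    (T : measurableType d) (P : probability T R) (X Y : {RV P >-> R}) : Prop :=
  forall A B : set R, measurable A -> measurable B ->
    P (X @^-1` A `&` Y @^-1` B) = (P (X @^-1` A) * P (Y @^-1` B))%E.

Definition mutually_independent (R : realType) (d : measure_display)
    (T : measurableType d) (P : probability T R) (n : nat)
    (X : 'I_n -> {RV P >-> R}) : Prop :=
  forall (J : {set 'I_n}) (A : 'I_n -> set R),
    (forall i, measurable (A i)) ->
    P (\bigcap_(i in [set` J]) X i @^-1` A i) =
    (\prod_(i in J) P (X i @^-1` A i))%E.

(* Laplace law with location 0 and rate lambda (inverse of the scale). *)
Definition laplace_pdf (R : realType) (lambda x : R) : R :=
  lambda / 2 * expR (- lambda * `|x|).

Record compound_laplace (R : realType) (d : measure_display)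
    (T : measurableType d) (P : probability T R) (n : nat) (lambda : R)
    (pZ : 'I_n -> R -> R) (Z L C : 'I_n -> {RV P >-> R}) : Prop := {
  cl_rate_gt0 : 0 < lambda;
  cl_mixing_density : forall i, has_density (Z i) (EFin \o pZ i);
  cl_mixing_support : forall i z, z < 0 -> pZ i z = 0;
  cl_laplace : forall i, has_density (L i) (EFin \o laplace_pdf lambda);
  cl_indepZL : forall i, independent2 (Z i) (L i);
  cl_product : forall i t, C i t = Z i t * L i t;
  cl_independent : mutually_independent C }.

(* Densities are only unique almost everywhere; this formula fixes the version
   whose pointwise values are used; [compound_laplace_has_density] shows that it
   is indeed a density of C i. *)
Definition cl_pdf (R : realType) (lambda : R) (pZ : R -> R) (c : R) : \bar R :=
  (\int[lebesgue_measure]_(z in `]0%R, +oo[)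
     (lambda / 2 * expR (- lambda * `|c| / z) * (pZ z / z))%:E)%E.

Section cl_pdf_density.
Context (R : realType).
Local Notation mu := (@lebesgue_measure R).

Lemma ge0_integral_has_density (d : measure_display) (T : measurableType d)
    (P : probability T R) (X : {RV P >-> R}) (p g : R -> \bar R) :
  has_density X p -> measurable_fun setT g -> (forall x, 0 <= g x)%E ->
  (\int[distribution P X]_x g x = \int[mu]_x (g x * p x))%E.
Proof.
move=> [mp p0 pE] mg g0.
have mX : measurable_fun setT (X : T -> measurableTypeR R).
  exact: (@measurable_funPT _ _ _ _ X).
pose X' : {mfun T >-> measurableTypeR R} :=
  HB.pack (X : T -> measurableTypeR R) (isMeasurableFun.Build _ _ _ _ _ mX).
pose nu : {finite_measure set (measurableTypeR R) -> \bar R} := distribution P X'.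
have nuE A : measurable A -> nu A = (\int[mu]_(x in A) p x)%E by exact: pE.
have dom : nu `<< mu.
  apply/null_content_dominatesP => A mA A0; rewrite nuE//.
  by apply: null_set_integral => //; exact: measurable_funTS.
transitivity (\int[nu]_x g x)%E.
  by rewrite [RHS]ge0_integral_distribution// ge0_integral_distribution.
rewrite -(Radon_Nikodym_SigmaFinite.change_of_variables dom)//.
have fint := Radon_Nikodym_SigmaFinite.f_integrable dom.
apply: ge0_ae_eq_integral => //.
- by apply: emeasurable_funM => //; exact: measurable_int fint.
- exact: emeasurable_funM.
- by move=> x _; rewrite mule_ge0//; exact: Radon_Nikodym_SigmaFinite.f_ge0.
- by move=> x _; rewrite mule_ge0.
- apply: ae_eqe_mul2l; apply: integral_ae_eq => // E _ mE.
  by rewrite -Radon_Nikodym_SigmaFinite.f_integral// nuE.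
Qed.

Lemma ge0_integral_dilation (z : R) (h : R -> \bar R) (A : set R) :
  0 < z -> measurable A -> measurable_fun setT h -> (forall x, 0 <= h x)%E ->
  (\int[mu]_(l in *%R z @^-1` A) h l =
   (z^-1)%:E * \int[mu]_(x in A) h (x / z)%R)%E.
Proof.
move=> z0 mA mh h0.
have mz : measurable_fun setT ( *%R z : _ -> measurableTypeR R).
  exact: measurable_funM.
have mdiv : measurable_fun setT (fun x : R => h (x / z)).
  by apply: (measurableT_comp mh); exact: measurable_funM.
have zi0 : 0 <= z^-1 by rewrite invr_ge0 ltW.
rewrite -[z^-1]/((NngNum zi0)%:num) -ge0_integral_mscale//; last first.
  exact: measurable_funTS.
transitivity (\int[pushforward mu ( *%R z : _ -> measurableTypeR R)]_(x in A)
    h (x / z)%R)%E.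
  rewrite ge0_integral_pushforward//; last exact: measurable_funTS.
  have zK (y : R) : z * y / z = y by rewrite mulrAC divff ?mul1r// gt_eqF.
  by apply: eq_integral => x _ /=; rewrite zK.
apply: eq_measure_integral => B mB _.
pose nu := mscale (NngNum (ltW z0)) (pushforward mu ( *%R z : _ -> measurableTypeR R)).
have nuE : mu B = nu mz B.
  apply: (@lebesgue_measure_unique R (nu mz)) => // _ [[a b]] _ <-.
  rewrite -[RHS]/(z%:E * mu ( *%R z @^-1` `]a, b]%classic))%E.
  rewrite (_ : *%R z @^-1` _ = `](a / z), (b / z)]%classic); last first.
    by apply/seteqP; split => x /=;
      rewrite !in_itv/= ltr_pdivrMr// ler_pdivlMr// ![x * z]mulrC.
  rewrite !lebesgue_measure_itv/= !lte_fin ltr_pM2r ?invr_gt0//.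
  case: ifPn => _; last by rewrite mule0.
  by rewrite -EFinB -EFinM -mulrBl mulrCA divff ?mulr1// gt_eqF.
rewrite -[RHS]/((z^-1)%:E * mu B)%E nuE.
rewrite -[RHS]/((z^-1)%:E * (z%:E * mu ( *%R z @^-1` B)))%E.
by rewrite muleA -EFinM mulVf ?mul1e// gt_eqF.
Qed.

Lemma cl_pdf_has_density (d : measure_display) (T : measurableType d)
    (P : probability T R) (lambda : R) (pZ : R -> R) (Z L C : {RV P >-> R}) :
  0 < lambda -> has_density Z (EFin \o pZ) -> (forall z, z < 0 -> pZ z = 0) ->
  has_density L (EFin \o laplace_pdf lambda) -> independent2 Z L ->
  (forall t, C t = Z t * L t) -> has_density C (cl_pdf lambda pZ).
Proof.
move=> l0 dZ sZ dL indep CE.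
have [mpZ0 pZ0 _] := dZ; have [_ _ LE] := dL.
have mpZ : measurable_fun setT pZ by exact/measurable_EFinP.
have {}pZ0 z : 0 <= pZ z by have := pZ0 z; rewrite lee_fin.
pose V (z : R) := expR (- ln z).
have VE z : 0 < z -> V z = z^-1 by move=> z0; rewrite /V expRN lnK.
have mV : measurable_fun setT V.
  apply: (measurableT_comp (@measurable_expR R)); apply: measurable_funN.
  exact: measurable_ln.
pose k (u : R * R) : R :=
  lambda / 2 * expR (- lambda * `|u.2| * V u.1) * (pZ u.1 * V u.1).
have k0 u : 0 <= k u by rewrite !mulr_ge0 ?expR_ge0// ltW.
have mk : measurable_fun setT k.
  have mV1 : measurable_fun setT (fun u : R * R => V u.1).
    exact: (measurableT_comp mV).
  have mp1 : measurable_fun setT (fun u : R * R => pZ u.1).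
    exact: (measurableT_comp mpZ).
  apply: measurable_funM; last exact: measurable_funM.
  apply: measurable_funM => //; apply: (measurableT_comp (@measurable_expR R)).
  apply: measurable_funM => //; apply: measurable_funM => //.
  exact: (measurableT_comp (@normr_measurable R setT)).
pose K (A : set R) (u : R * R) : \bar R :=
  (((EFin \o k) \_ (`]0%R, +oo[ `*` A)) u).
have mK A : measurable A -> measurable_fun setT (K A).
  move=> mA; apply/(measurable_restrictT _ _).1; first exact: measurableX.
  by apply: measurable_funTS; exact/measurable_EFinP.
have K0 A u : (0 <= K A u)%E.
  by rewrite /K patchE; case: ifP => // _; rewrite lee_fin.
have K_in (A : set R) z x : 0 < z -> A x ->
    K A (z, x) = (lambda / 2 * expR (- lambda * `|x| / z) * (pZ z / z))%:E.
  by move=> z0 Ax; rewrite /K patchE mem_set/= ?in_itv/= ?z0// /k/= VE.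
have K_out1 A z x : ~ 0 < z -> K A (z, x) = 0%E.
  by move=> z0; rewrite /K patchE memNset//= in_itv/= andbT => -[].
have K_out2 A z x : ~ A x -> K A (z, x) = 0%E.
  by move=> Ax; rewrite /K patchE memNset//= => -[].
have KE (A : set R) x : A x -> (\int[mu]_z K A (z, x) = cl_pdf lambda pZ x)%E.
  move=> Ax; rewrite /cl_pdf [RHS]integral_mkcond; apply: eq_integral => z _.
  rewrite patchE; case: ifPn; rewrite ?inE ?notin_setE/= in_itv/= andbT => z0.
    by rewrite K_in.
  exact: K_out1.
split.
- rewrite (_ : cl_pdf lambda pZ = fun x => (\int[mu]_z K setT (z, x))%E); last first.
    by apply/funext => x; rewrite KE.
  exact: (@measurable_fun_fubini_tonelli_G _ _ _ _ _ mu (K setT) (mK _ measurableT) (K0 setT)).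
- move=> x; apply: integral_ge0 => z; rewrite /= in_itv/= andbT => z0.
  by rewrite lee_fin !mulr_ge0 ?expR_ge0 ?invr_ge0// ltW.
move=> A mA.
pose B : set (R * R) := [set u | A (u.1 * u.2)].
have mB : measurable B.
  rewrite -[B]setTI.
  have mm : measurable_fun setT (fun u : R * R => u.1 * u.2).
    exact: measurable_funM.
  exact: mm.
have mW : measurable_fun setT (fun t => (Z t, L t)).
  exact: measurable_fun_pair.
pose W : {mfun T >-> (R * R)%type} := HB.pack (fun t => (Z t, L t))
  (isMeasurableFun.Build _ _ _ _ _ mW).
have -> : P (C @^-1` A) = distribution P W B.
  rewrite /distribution /pushforward; congr (P _).
  by apply/seteqP; split => t /=; rewrite /B/= CE.
have prodE : (distribution P Z \x distribution P L)%E B = distribution P W B.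
  by apply: product_measure_unique => // A1 A2 mA1 mA2; exact: indep.
rewrite -prodE -[LHS]/(\int[distribution P Z]_z (distribution P L (xsection B z)))%E.
rewrite (ge0_integral_has_density dZ)//; last first.
  exact: measurable_fun_xsection.
transitivity (\int[mu]_z \int[mu]_x K A (z, x))%E; last first.
  apply: (etrans (@fubini_tonelli _ _ _ _ _ mu mu (K A) (mK _ mA) (K0 A))).
  rewrite [RHS]integral_mkcond; apply: eq_integral => x _.
  rewrite patchE; case: ifPn; rewrite ?inE ?notin_setE => Ax; first exact: KE.
  by apply: integral0_eq => z _; exact: K_out2.
have mF : measurable_fun setT (fun z => \int[mu]_x K A (z, x))%E.
  exact: (@measurable_fun_fubini_tonelli_F _ _ _ _ _ mu (K A) (mK _ mA) (K0 A)).
have mG : measurable_fun setT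
    (fun z => distribution P L (xsection B z) * (pZ z)%:E)%E.
  by apply: emeasurable_funM => //; exact: measurable_fun_xsection.
have nz (f : R -> \bar R) : measurable_fun setT f ->
    (\int[mu]_(z in setT `\ 0%R) f z = \int[mu]_z f z)%E.
  by move=> mf; apply: integral_setD1; [exact: measurableD|exact: measurable_funTS].
rewrite -[LHS]nz// -[RHS]nz//; apply: eq_integral => z; rewrite inE/= => -[_ z0].
have [zlt0|zgt0|//] := ltgtP z 0.
  rewrite sZ// mule0 integral0_eq// => x _; apply: K_out1.
  by apply/negP; rewrite -leNgt ltW.
rewrite /distribution /pushforward/= LE; last exact: measurable_xsection.
rewrite (_ : xsection B z = *%R z @^-1` A); last first.
  by apply/seteqP; split => l; rewrite /xsection/= inE.
have mlap : measurable_fun setT (EFin \o laplace_pdf lambda) by have [] := dL.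
have lap0 x : (0 <= (EFin \o laplace_pdf lambda) x)%E by have [] := dL.
rewrite ge0_integral_dilation//.
rewrite [in RHS](_ : (fun x => K A (z, x)) =
  (fun x => K A (z, x)) \_ A); last first.
  apply/funext => x; rewrite patchE; case: ifPn => //.
  by rewrite notin_setE => Ax; exact: K_out2.
rewrite -integral_mkcond -muleAC.
rewrite -EFinM -ge0_integralZl//=; first last.
- by rewrite lee_fin mulr_ge0 ?invr_ge0// ltW.
- by move=> x _; exact: lap0.
- apply: measurable_funTS; apply: (measurableT_comp mlap).
  exact: measurable_funM.
apply: eq_integral => x; rewrite inE => Ax.
rewrite K_in// -EFinM /laplace_pdf; congr EFin.
by rewrite normrM normfV (gtr0_norm zgt0) [RHS]mulrC [_^-1 * _]mulrC !mulrA.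
Qed.

Lemma compound_laplace_has_density (d : measure_display)
    (T : measurableType d) (P : probability T R) (n : nat) (lambda : R)
    (pZ : 'I_n -> R -> R) (Z L C : 'I_n -> {RV P >-> R}) :
  compound_laplace lambda pZ Z L C ->
  forall i, has_density (C i) (cl_pdf lambda (pZ i)).
Proof.
move=> [l0 dZ sZ dL indep CE _] i.
by apply: (cl_pdf_has_density l0 (dZ i) _ (dL i) (indep i)) => //; exact: sZ.
Qed.

End cl_pdf_density.

(* [fine] sends +oo to 0 and [ln] sends nonpositive reals to 0, so this is the
   intended quantity only when 0 < p 0 < +oo and 0 < p c < +oo. *)
Definition neg_log_ratio (R : realType) (p : R -> \bar R) (c : R) : R :=
  ln (fine (p 0) / fine (p c)).

Definition cl_reg (R : realType) (n : nat) (lambda : R) (pZ : 'I_n -> R -> R)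
    (c : 'rV[R]_n) : R :=
  \sum_(i < n) neg_log_ratio (cl_pdf lambda (pZ i)) (c ord0 i).

Definition subadditive_fun (R : realType) (n : nat) (f : 'rV[R]_n -> R) : Prop :=
  forall x y, f (x + y) <= f x + f y.

Definition even_fun (R : realType) (n : nat) (f : 'rV[R]_n -> R) : Prop :=
  forall x, f (- x) = f x.

(* Main.v *)
Require Import Defs.
From HB Require Import structures.
From mathcomp Require Import all_boot all_order all_algebra.
From mathcomp Require Import all_classical all_reals all_analysis measurable_realfun.
From mathcomp Require Import ring.

Import Order.TTheory GRing.Theory Num.Theory.
Import numFieldNormedType.Exports.
Local Open Scope classical_set_scope.
Local Open Scope ring_scope.

(** Write [p] for the density of one component. On [0 < z] the mixture formula
reads [p c = \int exp (- a / z) w z dz] with [a = lambda * `|c|] and a weight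
[w >= 0] that does not depend on [c]. So [p c] is the value at [`|c|] of a
nonincreasing function, which makes [R] even, and the triangle inequality
reduces subadditivity to [p x * p y <= p 0 * p (`|x| + `|y|)]
([Rintegral_expR_supermul]). After division by [p 0 ^+ 2] this is Chebyshev's
association inequality: under the probability law proportional to [w], the
variables [exp (- a / z)] and [exp (- b / z)] are both nondecreasing in [z],
hence nonnegatively correlated.

The logarithms are meaningful because [0 < p c <= p 0 < +oo]: if [p c] vanished,
the mixing density would vanish almost everywhere on the half-line, although it
has mass one there ([ge0_integral_mul_gt0], [mixing_mass]). *)

(** * Laplace transforms of a weight *)

Section exponential_tilting.
Context {d : measure_display} {T : measurableType d} {R : realType}.
Context {mu : {measure set T -> \bar R}} {D : set T} {w s : T -> R}.
Hypotheses (mD : measurable D) (ms : measurable_fun D s).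
Hypotheses (w0 : forall x, D x -> 0 <= w x) (s0 : forall x, D x -> 0 <= s x).
Hypothesis iw : mu.-integrable D (EFin \o w).

Let mw : measurable_fun D w.
Proof. by apply/measurable_EFinP; exact: measurable_int iw. Qed.

Lemma measurable_expR_mul (a : R) :
  measurable_fun D (fun x => expR (- (a * s x)) * w x).
Proof.
apply: measurable_funM => //; apply: measurableT_comp => //.
by apply: measurable_funN; exact: measurable_funM.
Qed.

Lemma expR_mul_le {a b : R} {x} : a <= b -> D x ->
  expR (- (b * s x)) * w x <= expR (- (a * s x)) * w x.
Proof.
by move=> ab Dx; rewrite ler_wpM2r ?w0// ler_expR lerN2 ler_wpM2r ?s0.
Qed.

Lemma integrable_expR_mul {a : R} : 0 <= a ->
  mu.-integrable D (EFin \o (fun x => expR (- (a * s x)) * w x)).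
Proof.
move=> a0; apply: le_integrable iw => //.
  exact/measurable_EFinP/measurable_expR_mul.
move=> x Dx; rewrite /= lee_fin !ger0_norm ?mulr_ge0 ?w0 ?expR_ge0//.
by have := expR_mul_le a0 Dx; rewrite mul0r oppr0 expR0 mul1r.
Qed.

Lemma Rintegral_expR_le {a b : R} : 0 <= a -> a <= b ->
  \int[mu]_(x in D) (expR (- (b * s x)) * w x) <=
  \int[mu]_(x in D) (expR (- (a * s x)) * w x).
Proof.
move=> a0 ab; apply: le_Rintegral => //; try apply: integrable_expR_mul => //.
  exact: le_trans ab.
by move=> x Dx; exact: expR_mul_le.
Qed.

(** For [0 <= a] and [0 <= b] both [t |-> exp (- a * t)] and
[t |-> exp (- b * t)] are nonincreasing, so their increments between [u] and
[t] have the same sign. *)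
Lemma expR_comonotone {a b : R} (t u : R) : 0 <= a -> 0 <= b ->
  0 <= (expR (- (a * t)) - expR (- (a * u))) *
       (expR (- (b * t)) - expR (- (b * u))).
Proof.
move=> a0 b0; have [tu|/ltW ut] := leP t u.
  by rewrite mulr_ge0// subr_ge0 ler_expR lerN2 ler_wpM2l.
by rewrite mulr_le0// subr_le0 ler_expR lerN2 ler_wpM2l.
Qed.

(** Chebyshev's association inequality. The double integral of the usual proof
is avoided by comparing with a single point: if [m] denotes the [w]-mean of
[exp (- a * s)] and [u] the real number with [m = exp (- a * u)], then the
integral of [(exp (- a * s) - m) * (exp (- b * s) - exp (- b * u)) * w] is
nonnegative, and its terms carrying the factor [exp (- b * u)] cancel by the
choice of [m]. Such a [u] exists when [a] and [m] are nonzero; the inequality is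
immediate otherwise. *)
Lemma Rintegral_expR_supermul {a b : R} : 0 <= a -> 0 <= b ->
  \int[mu]_(x in D) (expR (- (a * s x)) * w x) *
  \int[mu]_(x in D) (expR (- (b * s x)) * w x) <=
  \int[mu]_(x in D) w x *
  \int[mu]_(x in D) (expR (- ((a + b) * s x)) * w x).
Proof.
pose phi c := \int[mu]_(x in D) (expR (- (c * s x)) * w x).
have phi_ge0 c : 0 <= phi c.
  by apply: Rintegral_ge0 => x Dx; rewrite mulr_ge0 ?w0 ?expR_ge0.
have phi0 : \int[mu]_(x in D) w x = phi 0.
  by apply: eq_Rintegral => x _; rewrite mul0r oppr0 expR0 mul1r.
move=> a0 b0; rewrite phi0 -/(phi a) -/(phi b) -/(phi (a + b)).
have [->|a_neq0] := eqVneq a 0; first by rewrite add0r.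
have [->|phia_neq0] := eqVneq (phi a) 0; first by rewrite mul0r mulr_ge0.
have phia_gt0 : 0 < phi a by rewrite lt_neqAle eq_sym phia_neq0 phi_ge0.
have W_gt0 : 0 < phi 0 by rewrite (lt_le_trans phia_gt0)// Rintegral_expR_le.
pose m := phi a / phi 0; have m_gt0 : 0 < m by rewrite divr_gt0.
pose u := - ln m / a; pose k := expR (- (b * u)).
have mE : m = expR (- (a * u)).
  by rewrite /u mulrCA divff// mulr1 opprK lnK.
have phiM : phi a = m * phi 0 by rewrite /m divfK// gt_eqF.
suff : m * phi b + k * phi a <= phi (a + b) + k * m * phi 0.
  rewrite phiM -mulrA lerD2r => mphi.
  by rewrite mulrAC [_ * phi (a + b)]mulrC ler_pM2r.
have iZ c e : 0 <= e ->
    mu.-integrable D (EFin \o (fun x => c * (expR (- (e * s x)) * w x))).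
  by move=> e0; exact: (integrableZl mD c (integrable_expR_mul e0)).
have iab : mu.-integrable D (EFin \o (fun x => expR (- ((a + b) * s x)) * w x)).
  by apply: integrable_expR_mul; rewrite addr_ge0.
rewrite -!RintegralZl//; try exact: integrable_expR_mul.
rewrite -!RintegralD//; try exact: iZ.
apply: le_Rintegral => //.
- exact: (integrableD mD (iZ m b b0) (iZ k a a0)).
- exact: (integrableD mD iab (iZ (k * m) 0 (lexx 0))).
move=> x Dx /=; have := expR_comonotone (s x) u a0 b0; rewrite -mE -/k => le0.
rewrite mul0r oppr0 expR0 mul1r mulrDl opprD expRD -subr_ge0.
by have := mulr_ge0 le0 (w0 x Dx); congr (0 <= _); ring.
Qed.

End exponential_tilting.

(** If the integral of [g * f] were zero, then [g * f], and with it [f], would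
vanish almost everywhere on [D]. *)
Lemma ge0_integral_mul_gt0 {d : measure_display} {T : measurableType d}
    {R : realType} (mu : {measure set T -> \bar R}) (D : set T) (f g : T -> R) :
  measurable D -> measurable_fun D f -> measurable_fun D g ->
  (forall x, D x -> 0 <= f x) -> (forall x, D x -> 0 < g x) ->
  (0 < \int[mu]_(x in D) (f x)%:E)%E ->
  (0 < \int[mu]_(x in D) (g x * f x)%:E)%E.
Proof.
move=> mD mf mg f0 g0 If.
have gf0 x : D x -> 0 <= g x * f x by move=> Dx; rewrite mulr_ge0 ?f0// ltW ?g0.
rewrite lt_neqAle integral_ge0 ?andbT; last by move=> x /gf0; rewrite lee_fin.
apply/eqP => I0; move: If.
suff -> : (\int[mu]_(x in D) (f x)%:E = 0)%E by rewrite ltxx.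
have absE (h : T -> R) : (forall x, D x -> 0 <= h x) ->
    (\int[mu]_(x in D) `|(h x)%:E| = \int[mu]_(x in D) (h x)%:E)%E.
  move=> h0; apply: eq_integral => x; rewrite inE => Dx.
  by rewrite gee0_abs// lee_fin h0.
have mgf : measurable_fun D (fun x => (g x * f x)%:E).
  by apply/measurable_EFinP; exact: measurable_funM.
have /(ae_eq_integral_abs mu mD mgf) gf_ae :
    (\int[mu]_(x in D) `|(g x * f x)%:E| = 0)%E by rewrite absE.
rewrite -absE//; apply/(ae_eq_integral_abs mu mD).
  exact/measurable_EFinP.
apply: filterS gf_ae => x gfx Dx; have /eqP := gfx Dx.
by rewrite /= eqe mulf_eq0 gt_eqF ?g0//= => /eqP ->.
Qed.

(** * One component *)

Section cl_component.
Context {R : realType}.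
Variables (lambda : R) (pZ : R -> R).
Local Notation mu := (@lebesgue_measure R).
Local Notation D := (`]0%R, +oo[%classic : set R).
Local Notation p := (cl_pdf lambda pZ).
Hypothesis lambda_gt0 : 0 < lambda.
Hypothesis mpZ : measurable_fun setT pZ.
Hypothesis pZ_ge0 : forall z, 0 <= pZ z.
Hypothesis mass_gt0 : (0 < \int[mu]_(z in D) (pZ z)%:E)%E.
Hypothesis p0_fin : (p 0 < +oo)%E.

Let w (z : R) := lambda / 2 * (pZ z / z).

Let D_gt0 {z : R} : D z -> 0 < z.
Proof. by rewrite /= in_itv/= andbT. Qed.

Let mD : measurable D. Proof. exact: measurable_itv. Qed.

Let measurable_inv_pos : measurable_fun D (fun z : R => z^-1).
Proof.
(* on the half-line, the inverse of [z] is [exp (- ln z)] *)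
apply: (@eq_measurable_fun _ _ _ _ _ (fun z : R => expR (- ln z))).
  by move=> z; rewrite inE => /D_gt0 z0; rewrite expRN lnK.
apply: measurable_funTS; apply: measurableT_comp => //.
by apply: measurable_funN; exact: measurable_ln.
Qed.

Let w_ge0 z : D z -> 0 <= w z.
Proof.
by move=> /D_gt0 z0; rewrite !mulr_ge0 ?invr_ge0 ?pZ_ge0 ?(ltW lambda_gt0)// ltW.
Qed.

Let inv_ge0 (z : R) : D z -> 0 <= z^-1.
Proof. by move=> /D_gt0 z0; rewrite invr_ge0 ltW. Qed.

Let mw : measurable_fun D w.
Proof.
apply: measurable_funM => //; apply: measurable_funM => //.
exact: measurable_funTS.
Qed.

Let pE (c : R) : p c =
  (\int[mu]_(z in D) (expR (- (lambda * `|c| * z^-1)) * w z)%:E)%E.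
Proof.
by apply: eq_integral => z _; rewrite /w !mulNr mulrAC mulrC.
Qed.

Let p0E : p 0 = (\int[mu]_(z in D) (w z)%:E)%E.
Proof.
by rewrite pE; apply: eq_integral => z _;
  rewrite normr0 mulr0 mul0r oppr0 expR0 mul1r.
Qed.

Let iw : mu.-integrable D (EFin \o w).
Proof.
apply/integrableP; split; first exact/measurable_EFinP.
rewrite (le_lt_trans _ p0_fin)// p0E le_eqVlt; apply/orP; left; apply/eqP.
apply: eq_integral => z; rewrite inE => Dz.
by rewrite gee0_abs// lee_fin w_ge0.
Qed.

Let la_ge0 (c : R) : 0 <= lambda * `|c|.
Proof. by rewrite mulr_ge0// ltW. Qed.

Lemma cl_pdf_bounds c : (0 < p c < +oo)%E.
Proof.
rewrite pE; apply/andP; split; last first.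
  (* [T] is given because unification, from the measurability of [D], would
     pick the canonical structure of [R]; Lebesgue measure is on the convertible
     [measurableTypeR R], which has another display. *)
  have := integrable_expR_mul (T := measurableTypeR R) mD measurable_inv_pos
    w_ge0 inv_ge0 iw (la_ge0 c).
  move=> /(integrable_fin_num (T := measurableTypeR R) mD).
  by rewrite fin_numE -ltey => /andP[].
rewrite [ltRHS](_ : _ = (\int[mu]_(z in D)
    (expR (- (lambda * `|c| * z^-1)) * (lambda / 2) * z^-1 * pZ z)%:E)%E).
  apply: ge0_integral_mul_gt0 => //.
  - exact: measurable_funTS.
  - apply: measurable_funM => //; apply: measurable_funM => //.
    apply: measurableT_comp => //; apply: measurable_funN.
    exact: measurable_funM.
  - by move=> z /D_gt0 z0; rewrite !mulr_gt0 ?expR_gt0 ?invr_gt0.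
by apply: eq_integral => z _; rewrite /w -!mulrA [_^-1 * pZ z]mulrC.
Qed.

Let q (c : R) := fine (p c).

Lemma cl_pdf_fine_gt0 c : 0 < q c.
Proof. by rewrite fine_gt0// cl_pdf_bounds. Qed.

Lemma cl_pdf_supermul x y : q x * q y <= q 0 * q (x + y).
Proof.
have := Rintegral_expR_supermul (T := measurableTypeR R) mD measurable_inv_pos
  w_ge0 inv_ge0 iw (la_ge0 x) (la_ge0 y).
rewrite /q p0E !pE => /le_trans; apply.
apply: ler_wpM2l; first exact: Rintegral_ge0.
rewrite -mulrDr; apply: Rintegral_expR_le => //.
by rewrite ler_pM2l// ler_normD.
Qed.

Lemma neg_log_ratio_subadditive x y :
  neg_log_ratio p (x + y) <= neg_log_ratio p x + neg_log_ratio p y.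
Proof.
have q_gt0 := cl_pdf_fine_gt0.
have r_gt0 c : 0 < q 0 / q c by rewrite divr_gt0.
rewrite /neg_log_ratio -/(q 0) -/(q x) -/(q y) -/(q (x + y)).
rewrite -lnM ?posrE// ler_ln ?posrE//; last exact: mulr_gt0.
rewrite mulf_div ler_pdivrMr// mulrAC ler_pdivlMr ?mulr_gt0//.
by rewrite -mulrA ler_pM2l// cl_pdf_supermul.
Qed.

End cl_component.

Lemma neg_log_ratio_even {R : realType} (lambda : R) (pZ : R -> R) (c : R) :
  neg_log_ratio (cl_pdf lambda pZ) (- c) = neg_log_ratio (cl_pdf lambda pZ) c.
Proof. by rewrite /neg_log_ratio /cl_pdf normrN. Qed.

(** The point [0] is Lebesgue-null, so a density that vanishes on the negative
reals puts its whole mass on the open half-line, the domain of integration in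
[cl_pdf]. *)
Lemma mixing_mass {R : realType} {d : measure_display} {T : measurableType d}
    {P : probability T R} {Z : {RV P >-> R}} {pZ : R -> R} :
  has_density Z (EFin \o pZ) -> (forall z, z < 0 -> pZ z = 0) ->
  (\int[@lebesgue_measure R]_(z in `]0%R, +oo[) (pZ z)%:E = 1)%E.
Proof.
move=> [mpZ _ pZE] pZ_neg.
rewrite -(@probability_setT _ _ _ P) -(@preimage_setT _ _ Z) pZE//.
rewrite -[RHS](@integral_setD1 _ _ 0%R); first last.
- exact: measurable_funTS.
- exact: measurableD.
rewrite [LHS]integral_mkcond [RHS]integral_mkcond; apply: eq_integral => z _.
rewrite !patchE; have [z0|z0|->] := ltgtP z 0.
- by rewrite memNset ?if_same /= ?pZ_neg ?if_same// in_itv/= andbT ltNge ltW.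
- rewrite !mem_set//=; last by rewrite in_itv/= andbT.
  by split => // z00; rewrite z00 ltxx in z0.
- by rewrite !memNset//=; [case|rewrite in_itv/= ltxx].
Qed.

Theorem mainTheorem3 (R : realType) (d : measure_display)
    (T : measurableType d) (P : probability T R) (n : nat) (lambda : R)
    (pZ : 'I_n -> R -> R) (Z L C : 'I_n -> {RV P >-> R})
    (hCL : compound_laplace lambda pZ Z L C)
    (hfin : forall i, (cl_pdf lambda (pZ i) 0 < +oo)%E) :
  [/\ (forall i c, (0 < cl_pdf lambda (pZ i) c < +oo)%E),
      subadditive_fun (cl_reg lambda pZ) &
      even_fun (cl_reg lambda pZ)].
Proof.
have [lambda_gt0 dZ sZ _ _ _ _] := hCL.
have mpZ i : measurable_fun setT (pZ i).
  by have [mZ _ _] := dZ i; exact/measurable_EFinP.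
have pZ_ge0 i z : 0 <= pZ i z.
  by have [_ pZ0 _] := dZ i; have := pZ0 z; rewrite lee_fin.
have mass i : (0 < \int[@lebesgue_measure R]_(z in `]0%R, +oo[) (pZ i z)%:E)%E.
  by rewrite (mixing_mass (dZ i) (sZ i)).
split.
- by move=> i c; exact: cl_pdf_bounds.
- move=> x y; rewrite /cl_reg -big_split/=; apply: ler_sum => i _.
  by rewrite mxE; exact: neg_log_ratio_subadditive.
- move=> x; rewrite /cl_reg; apply: eq_bigr => i _.
  by rewrite mxE neg_log_ratio_even.
Qed.
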